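(* Let $p\in\mathbb N$, $p\geq 1$, and let $f:[0,\infty)\to\mathbb R$ be $p-1$ times continuously differentiable, with $f^{(p)}$ existing except possibly at finitely many points of each bounded interval and piecewise continuous, and with $f,f',\dots,f^{(p)}$ of exponential order $r$, where $r>0$. Let $s>r$, and let $\varphi_n(s)=\int_0^\infty e^{-st}\frac{t^n}{n!}f(t)\,dt$ for $n\in\mathbb N\cup\{0\}$. Then for every $n\in\mathbb N\cup\{0\}$ $$\int_0^\infty e^{-st}\frac{t^n}{n!}f^{(p)}(t)\,dt=\begin{cases}\nabla_s^p\varphi_n(s), & n\ge p,\\[1mm] \nabla_s^p\varphi_n(s)-(-1)^n\displaystyle\sum_{j=1}^{p-n}\binom{p-j}{n}s^{p-j-n}f^{(j-1)}(0), & n\le p-1.\end{cases}$$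
   Context: A function $h$ is of exponential order $r$ if there is $M>0$ such that $|h(t)|<Me^{rt}$ for all $t$ where it is defined. The generalized backward difference operator is $\nabla_s\varphi_n(s)=s\varphi_n(s)-\varphi_{n-1}(s)$, and its powers are $$\nabla_s^p\varphi_n(s)=\sum_{k=0}^p(-1)^k\binom pk s^{p-k}\varphi_{n-k}(s),$$ with the convention $\varphi_m(s)=0$ for $m<0$. *)

(* Defs.v *)
From Stdlib Require Import Reals Lra Lia List ZArith.
From Coquelicot Require Import Coquelicot.
Open Scope R_scope.

(** A function [0,oo) -> R is represented by [f : R -> R]; every notion below
    involves the values of [f] on [0,oo) only. *)
Definition ray (t : R) : Prop := 0 <= t.

(** Derivatives are taken within [0,oo), hence are right derivatives at 0.
    [Derive_ray f t] is a junk value when the derivative does not exist, in the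
    manner of [Derive] and [Derive_n]. *)
Definition ex_derive_ray (f : R -> R) (t : R) : Prop :=
  exists l : R, D_in f (fun _ => l) ray t.

Definition Derive_ray (f : R -> R) (t : R) : R :=
  iota (fun l : R => D_in f (fun _ => l) ray t).

Fixpoint Derive_ray_n (f : R -> R) (k : nat) : R -> R :=
  match k with
  | O => f
  | S j => Derive_ray (Derive_ray_n f j)
  end.

(** As for [ex_derive_n], this means that the k-th derivative exists at [t] only
    when the derivatives of lower order exist around [t]. *)
Definition ex_derive_ray_n (f : R -> R) (k : nat) (t : R) : Prop :=
  match k with
  | O => True
  | S j => ex_derive_ray (Derive_ray_n f j) t
  end.

Definition C_ray (m : nat) (f : R -> R) : Prop :=
  (forall k : nat, (k <= m)%nat -> forall t, ray t -> ex_derive_ray_n f k t) /\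
  (forall k : nat, (k <= m)%nat -> continuous_on ray (Derive_ray_n f k)).

Definition holds_on_ray_but_finitely_many (P : R -> Prop) : Prop :=
  forall b : R, exists E : list R,
    forall t : R, 0 <= t <= b -> ~ In t E -> P t.

(** The values at the points of [E] are irrelevant, so this also makes sense for
    a function that is undefined at finitely many points of each bounded
    interval. *)
Definition piecewise_continuous_ray (h : R -> R) : Prop :=
  holds_on_ray_but_finitely_many
    (fun t => filterlim h (within ray (locally t)) (locally (h t))) /\
  (forall t : R, 0 <= t -> exists l : R, filterlim h (at_right t) (locally l)) /\
  (forall t : R, 0 < t -> exists l : R, filterlim h (at_left t) (locally l)).

Definition exponential_order (D : R -> Prop) (h : R -> R) (r : R) : Prop :=
  exists M : R, 0 < M /\ forall t : R, D t -> Rabs (h t) < M * exp (r * t).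

Definition laplace_integrand (n : nat) (s : R) (g : R -> R) (t : R) : R :=
  exp (- (s * t)) * (t ^ n / INR (fact n)) * g t.

(** Sequences are indexed by [Z] to accommodate the convention that they vanish
    at negative indices. *)
Definition phi (f : R -> R) (m : Z) (s : R) : R :=
  if (m <? 0)%Z then 0
  else RInt_gen (laplace_integrand (Z.to_nat m) s f)
         (at_point 0) (Rbar_locally p_infty).

Definition nabla (psi : Z -> R -> R) : Z -> R -> R :=
  fun n s => s * psi n s - psi (n - 1)%Z s.

Fixpoint nabla_pow (p : nat) (psi : Z -> R -> R) : Z -> R -> R :=
  match p with
  | O => psi
  | S q => nabla (nabla_pow q psi)
  end.

Lemma nabla_pow_binomial (p : nat) (psi : Z -> R -> R) (n : Z) (s : R) :
  nabla_pow p psi n s =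
  sum_f_R0 (fun k => (-1) ^ k * Binomial.C p k * s ^ (p - k)
                     * psi (n - Z.of_nat k)%Z s) p.
Proof.
revert n; induction p as [|p IH]; intros n.
- simpl; unfold Binomial.C; simpl.
  replace (n - 0)%Z with n by lia; field.
- change (nabla_pow (S p) psi n s)
    with (s * nabla_pow p psi n s - nabla_pow p psi (n - 1)%Z s).
  rewrite (IH n), (IH (n - 1)%Z).
  assert (Cn0 : forall m, Binomial.C m 0 = 1).
  { intros m; unfold Binomial.C; rewrite Nat.sub_0_r; simpl.
    field; apply INR_fact_neq_0. }
  assert (Cnn : forall m, Binomial.C m m = 1).
  { intros m; unfold Binomial.C; rewrite Nat.sub_diag; simpl.
    field; apply INR_fact_neq_0. }
  destruct p as [|p].
  + simpl; rewrite !Cn0, Cnn; simpl.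
    replace (n - 0)%Z with n by lia.
    replace (n - 1 - 0)%Z with (n - 1)%Z by lia; ring.
  + rewrite (decomp_sum _ (S (S p))) by lia.
    rewrite (decomp_sum _ (S p)) by lia.
    simpl Nat.pred.
    rewrite (tech5 (fun i => (-1) ^ S i * Binomial.C (S (S p)) (S i) * _ * _)).
    rewrite (tech5 (fun k => (-1) ^ k * Binomial.C (S p) k * _ * psi (n - 1 - _)%Z s)).
    rewrite !Cn0, !Cnn, !Nat.sub_diag, !Nat.sub_0_r.
    rewrite Rmult_plus_distr_l, scal_sum.
    replace (n - 1 - Z.of_nat (S p))%Z with (n - Z.of_nat (S (S p)))%Z by lia.
    transitivity
      (s ^ S (S p) * psi (n - Z.of_nat 0)%Z s
       + sum_f_R0 (fun i =>
           (-1) ^ S i * Binomial.C (S p) (S i) * s ^ (S p - S i)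
             * psi (n - Z.of_nat (S i))%Z s * s
           - (-1) ^ i * Binomial.C (S p) i * s ^ (S p - i)
             * psi (n - 1 - Z.of_nat i)%Z s) p
       - (-1) ^ S p * psi (n - Z.of_nat (S (S p)))%Z s).
    { rewrite minus_sum; simpl; ring. }
    rewrite (sum_eq _ (fun i => (-1) ^ S i * Binomial.C (S (S p)) (S i)
                * s ^ (S (S p) - S i) * psi (n - Z.of_nat (S i))%Z s)).
    { simpl; ring. }
    intros i Hi.
    rewrite <- (pascal (S p) i) by lia.
    replace (n - 1 - Z.of_nat i)%Z with (n - Z.of_nat (S i))%Z by lia.
    replace (S (S p) - S i)%nat with (S p - i)%nat by lia.
    replace (S p - i)%nat with (S (S p - S i)) by lia.
    simpl pow; ring.
Qed.

Lemma Derive_ray_unique (f : R -> R) (t l : R) :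
  0 <= t -> D_in f (fun _ => l) ray t -> Derive_ray f t = l.
Proof.
intros Ht Hl.
assert (U : forall a b : R, D_in f (fun _ => a) ray t ->
                            D_in f (fun _ => b) ray t -> a = b).
{ intros a b Ha Hb.
  refine (single_limit _ (D_x ray t) a b t _ Ha Hb).
  intros e He; exists (t + e / 2); unfold D_x, ray; repeat split; try lra.
  simpl; unfold Rdist; rewrite Rabs_pos_eq; lra. }
apply (U _ _); [| exact Hl].
unfold Derive_ray; apply (iota_correct (V := R_CompleteNormedModule)).
exists l; split; [exact Hl | intros y Hy; exact (U _ _ Hl Hy)].
Qed.

(* Main.v *)
Require Import Defs.
From Stdlib Require Import Reals List ZArith Lra Lia.
From Coquelicot Require Import Coquelicot.
Open Scope R_scope.

(** One integration by parts turns [g'] into [g]. The weight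
    [w_n(t) = exp (-st) t^n / n!] satisfies [w_n' = w_(n-1) - s w_n], so

      [int w_n g' = s int w_n g - int w_(n-1) g - [n = 0] g(0)],

    the boundary term at infinity vanishing because [g] is of exponential order
    [r < s]. Apart from the value [g(0)], which is felt only at [n = 0], this is
    one application of [nabla] to the sequence of integrals
    ([laplace_derivative_step]). Starting from [phi] and repeating this [p] times
    gives [nabla_pow p], minus the values [f^(j)(0)] carried along by the later
    applications of [nabla]. The correction after [p] steps obeys the recurrence
    [B_(p+1)(n) = s B_p(n) - B_p(n-1) + [n = 0] f^(p)(0)] with [B_p(-1) = 0], and Pascal's rule shows
    that the sum in the statement solves it ([boundary_0], [boundary_S]).

    Two analytic points remain. Integration by parts must allow finitely many
    points without derivative: [is_RInt_derive_off_list] is the fundamental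
    theorem of calculus for a continuous function whose derivative exists and is
    continuous off a finite set and has one-sided limits. As for
    convergence, [w_n g] is dominated by a decaying exponential
    ([laplace_integrand_dominated]), and the integral of [w_n g'] converges because
    the other terms of the identity on [0, b] do. *)

(** * Limits along the half-line *)

Lemma filterlim_Rplus {T : Type} (F : (T -> Prop) -> Prop) {FF : Filter F}
    (u v : T -> R) (a b : R) :
  filterlim u F (locally a) -> filterlim v F (locally b) ->
  filterlim (fun x => u x + v x) F (locally (a + b)).
Proof.
intros Hu Hv.
exact (filterlim_comp_2 _ _ Rplus Hu Hv (filterlim_plus (V := R_NormedModule) a b)).
Qed.

Lemma filterlim_Rmult {T : Type} (F : (T -> Prop) -> Prop) {FF : Filter F}
    (u v : T -> R) (a b : R) :
  filterlim u F (locally a) -> filterlim v F (locally b) ->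
  filterlim (fun x => u x * v x) F (locally (a * b)).
Proof.
intros Hu Hv.
exact (filterlim_comp_2 _ _ Rmult Hu Hv (filterlim_mult (K := R_AbsRing) a b)).
Qed.

Lemma at_right_le_ray (t : R) :
  0 <= t -> filter_le (at_right t) (within ray (locally t)).
Proof.
intros Ht P HP; unfold at_right, within in *.
revert HP; apply filter_imp; intros u Hu Hlt; apply Hu; unfold ray; lra.
Qed.

Lemma locally_le_ray (t : R) :
  0 < t -> filter_le (locally t) (within ray (locally t)).
Proof.
intros Ht P HP; unfold within in HP.
generalize (filter_and _ _ (open_gt 0 t Ht) HP).
apply filter_imp; intros u [Hu1 Hu2]; apply Hu2; unfold ray; lra.
Qed.

Lemma at_left_le_ray (t : R) :
  0 < t -> filter_le (at_left t) (within ray (locally t)).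
Proof.
intros Ht P HP; apply filter_le_within; now apply locally_le_ray.
Qed.

Lemma continuous_on_ray_piecewise (h : R -> R) :
  continuous_on ray h -> piecewise_continuous_ray h.
Proof.
intros Hc; split; [| split].
- intros b; exists nil; intros t Ht _; apply Hc; unfold ray; lra.
- intros t Ht; exists (h t).
  now apply (filterlim_filter_le_1 _ (at_right_le_ray t Ht)), Hc.
- intros t Ht; exists (h t).
  apply (filterlim_filter_le_1 _ (at_left_le_ray t Ht)), Hc; unfold ray; lra.
Qed.

Lemma ex_derive_ray_interior (f : R -> R) (t : R) :
  0 < t -> ex_derive_ray f t -> is_derive f t (Derive_ray f t).
Proof.
intros Ht [l Hl].
rewrite (Derive_ray_unique f t l); [| lra | exact Hl].
apply is_derive_Reals; intros eps Heps.
destruct (Hl eps Heps) as [d [Hd Hlim]].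
assert (Hm : 0 < Rmin d t) by (apply Rmin_pos; lra).
exists (mkposreal _ Hm); intros h Hh0 Hh; simpl in Hh.
generalize (Rmin_l d t) (Rmin_r d t); intros Hl1 Hl2.
assert (Hh' := Rabs_def2 _ _ Hh).
specialize (Hlim (t + h)); simpl in Hlim; unfold Rdist in Hlim.
replace (t + h - t) with h in Hlim by ring.
apply Hlim; split; [| lra].
unfold D_x, ray; split; lra.
Qed.

(** * The fundamental theorem of calculus with exceptional points *)

(** One-sided limits at [a] and [b] extend [K] and [G] continuously to the whole
    line; the extension of [G] minus a primitive of the extension of [K] has
    zero derivative on the open interval, so the mean value theorem applies. *)
Lemma is_RInt_derive_open (G K : R -> R) (a b la lb : R) :
  a < b ->
  filterlim G (at_right a) (locally (G a)) ->
  filterlim G (at_left b) (locally (G b)) ->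
  filterlim K (at_right a) (locally la) ->
  filterlim K (at_left b) (locally lb) ->
  (forall t, a < t < b -> is_derive G t (K t) /\ continuous K t) ->
  is_RInt K a b (G b - G a).
Proof.
intros Hab Ga Gb Ka Kb HGK.
destruct (C0_extension_lt K la lb a b Hab (fun t Ht => proj2 (HGK t Ht)) Ka Kb)
  as [K' [K'c [K'K _]]].
destruct (C0_extension_lt G (G a) (G b) a b Hab) as [G' [G'c [G'G [G'a G'b]]]];
  [| exact Ga | exact Gb |].
{ intros t Ht; apply (ex_derive_continuous (K := R_AbsRing) (V := R_NormedModule)).
  exists (K t); now apply HGK. }
assert (K'int : forall u v, ex_RInt K' u v).
{ intros u v; apply (ex_RInt_continuous (V := R_CompleteNormedModule)).
  intros z _; apply K'c. }
assert (Pder : forall t, is_derive (fun t => RInt K' a t) t (K' t)).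
{ intros t; apply (is_derive_RInt (V := R_NormedModule)) with a; [| apply K'c].
  apply filter_forall; intros u.
  apply (RInt_correct (V := R_CompleteNormedModule)), K'int. }
destruct (MVT_gen (fun t => G' t - RInt K' a t) a b (fun _ => 0)) as [c [_ Hc]].
- rewrite Rmin_left, Rmax_right by lra; intros t Ht.
  replace 0 with (K t - K' t) by (rewrite (K'K t Ht); ring).
  apply (is_derive_minus (V := R_NormedModule)); [| apply Pder].
  apply (is_derive_ext_loc (V := R_NormedModule) G); [| now apply HGK].
  assert (Hin : locally t (fun u => a < u /\ u < b)).
  { apply filter_and; [apply open_gt | apply open_lt]; lra. }
  revert Hin; apply filter_imp; intros u Hu; symmetry; now apply G'G.
- intros t _; apply continuity_pt_minus; apply continuity_pt_filterlim.
  + apply G'c.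
  + apply (ex_derive_continuous (K := R_AbsRing) (V := R_NormedModule)).
    exists (K' t); apply Pder.
- rewrite (RInt_point (V := R_CompleteNormedModule)) in Hc.
  change (@zero R_CompleteNormedModule) with 0 in Hc.
  rewrite G'a, G'b in Hc.
  replace (G b - G a) with (RInt K' a b) by lra.
  apply (is_RInt_ext (V := R_NormedModule) K').
  + rewrite Rmin_left, Rmax_right by lra; exact K'K.
  + apply (RInt_correct (V := R_CompleteNormedModule)), K'int.
Qed.

(** Induction on the list of exceptional points: one that lies strictly inside
    the interval splits it in two, any other one can be dropped. *)
Lemma is_RInt_derive_off_list (G K : R -> R) (E : list R) :
  forall a b : R, a <= b ->
  (forall t, a <= t < b -> filterlim G (at_right t) (locally (G t))) ->
  (forall t, a < t <= b -> filterlim G (at_left t) (locally (G t))) ->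
  (forall t, a <= t < b -> exists l, filterlim K (at_right t) (locally l)) ->
  (forall t, a < t <= b -> exists l, filterlim K (at_left t) (locally l)) ->
  (forall t, a < t < b -> ~ In t E -> is_derive G t (K t) /\ continuous K t) ->
  is_RInt K a b (G b - G a).
Proof.
induction E as [|x E IH]; intros a b Hab Gr Gl Kr Kl HGK;
  (destruct Hab as [Hab | <-];
   [| rewrite Rminus_diag; apply (is_RInt_point (V := R_NormedModule))]).
- destruct (Kr a) as [la Ha]; [lra |]; destruct (Kl b) as [lb Hb]; [lra |].
  apply (is_RInt_derive_open G K a b la lb); auto; try (apply Gr; lra);
    try (apply Gl; lra).
- destruct (Rlt_dec a x) as [Hax | Hax]; [destruct (Rlt_dec x b) as [Hxb | Hxb] |].
  + replace (G b - G a) with (plus (G x - G a) (G b - G x))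
      by (unfold plus; simpl; ring).
    apply (is_RInt_Chasles (V := R_NormedModule)) with x; apply IH;
      try lra; intros t Ht; try (apply Gr; lra); try (apply Gl; lra);
      try (apply Kr; lra); try (apply Kl; lra);
      intros HE; (apply HGK; [lra | intros [-> | HE']; [lra | now apply HE]]).
  + apply IH; auto; try lra.
    intros t Ht HE; apply HGK; [lra |]; intros [-> | HE']; [lra | now apply HE].
  + apply IH; auto; try lra.
    intros t Ht HE; apply HGK; [lra |]; intros [-> | HE']; [lra | now apply HE].
Qed.

(** * Improper integrals over the half-line *)

(** Reduces an improper integral to the limit of an antiderivative, so that the
    identity on [0, b] can be passed to the limit term by term. *)
Lemma is_RInt_gen_ray (F I : R -> R) (l : R) :
  (forall b, 0 <= b -> is_RInt F 0 b (I b)) ->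
  filterlim I (Rbar_locally p_infty) (locally l) ->
  is_RInt_gen F (at_point 0) (Rbar_locally p_infty) l.
Proof.
intros HI Hl P HP.
apply Filter_prod with (fun a => a = 0) (fun b => 0 <= b /\ P (I b)).
- reflexivity.
- apply filter_and; [exists 0; intros b Hb; lra | exact (Hl P HP)].
- intros a b -> [Hb HPb]; exists (I b); split; [now apply HI | exact HPb].
Qed.

Lemma filterlim_RInt_of_RInt_gen (F : R -> R) (l : R) :
  is_RInt_gen F (at_point 0) (Rbar_locally p_infty) l ->
  filterlim (fun b => RInt F 0 b) (Rbar_locally p_infty) (locally l).
Proof.
intros HF P HP.
destruct (HF P HP) as [Q S HQ HS HQS].
unfold filtermap; revert HS; apply filter_imp; intros b Hb.
destruct (HQS 0 b HQ Hb) as [y [Hy1 Hy2]]; simpl in Hy1.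
now rewrite (is_RInt_unique (V := R_CompleteNormedModule) _ _ _ _ Hy1).
Qed.

Lemma exp_decay (eps : R) :
  0 < eps ->
  filterlim (fun t => exp (- (eps * t))) (Rbar_locally p_infty) (locally 0).
Proof.
intros Heps.
apply (filterlim_comp _ _ _ (fun t => - (eps * t)) exp _ (Rbar_locally m_infty)).
- intros P [M HM]; exists (- M / eps); intros t Ht; apply HM.
  apply Rmult_lt_compat_l with (r := eps) in Ht; [| exact Heps].
  replace (eps * (- M / eps)) with (- M) in Ht by (field; lra); lra.
- exact is_lim_exp_m.
Qed.

Lemma filterlim_exp_dominated (F : R -> R) (c eps : R) :
  0 < eps ->
  (forall t, 0 <= t -> Rabs (F t) <= c * exp (- (eps * t))) ->
  filterlim F (Rbar_locally p_infty) (locally 0).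
Proof.
intros Heps HF.
assert (Hup : is_lim (fun t => c * exp (- (eps * t))) p_infty 0).
{ replace 0 with (c * 0) by ring.
  apply (is_lim_scal_l _ c p_infty 0); exact (exp_decay eps Heps). }
apply (is_lim_le_le_loc (fun t => - (c * exp (- (eps * t))))
                        (fun t => c * exp (- (eps * t))) F p_infty 0);
  [| | exact Hup].
- exists 0; intros t Ht; apply Rabs_le_between, HF; lra.
- replace (Finite 0) with (Rbar_opp 0) by (simpl; now rewrite Ropp_0).
  now apply is_lim_opp.
Qed.

(** Cauchy's criterion: the integral of the dominating exponential from [u] to
    [v] is at most [c / eps * exp (- (eps * u))], uniformly in [v]. *)
Lemma ex_RInt_gen_exp_dominated (F : R -> R) (c eps : R) :
  0 < eps ->
  (forall b, 0 <= b -> ex_RInt F 0 b) ->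
  (forall t, 0 <= t -> Rabs (F t) <= c * exp (- (eps * t))) ->
  ex_RInt_gen F (at_point 0) (Rbar_locally p_infty).
Proof.
intros Heps Hint HF.
assert (Hc : 0 <= c).
{ specialize (HF 0 (Rle_refl 0)); generalize (Rabs_pos (F 0)).
  rewrite Rmult_0_r, Ropp_0, exp_0, Rmult_1_r in HF; lra. }
assert (Htail : forall u v, 0 <= u <= v ->
          Rabs (RInt F 0 v - RInt F 0 u) <= c / eps * exp (- (eps * u))).
{ intros u v Huv.
  assert (Huv' : ex_RInt F u v).
  { apply (ex_RInt_Chasles_2 (V := R_CompleteNormedModule)) with 0; [lra |].
    apply Hint; lra. }
  assert (Hch : RInt F 0 u + RInt F u v = RInt F 0 v).
  { apply (RInt_Chasles (V := R_CompleteNormedModule)); [apply Hint; lra | exact Huv']. }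
  replace (RInt F 0 v - RInt F 0 u) with (0 + RInt F u v) by (rewrite <- Hch; ring).
  rewrite Rplus_0_l.
  apply Rle_trans with (minus (- (c / eps) * exp (- (eps * v)))
                              (- (c / eps) * exp (- (eps * u)))).
  - apply (norm_RInt_le (V := R_NormedModule) F (fun t => c * exp (- (eps * t))) u v);
      [lra | | |].
    + intros t Ht; apply HF; lra.
    + now apply (RInt_correct (V := R_CompleteNormedModule)).
    + apply (is_RInt_derive (V := R_CompleteNormedModule)
               (fun t => - (c / eps) * exp (- (eps * t)))); intros t _.
      * auto_derive; [trivial | field; lra].
      * apply (ex_derive_continuous (K := R_AbsRing) (V := R_NormedModule)).
        auto_derive; trivial.
  - unfold minus, plus, opp; simpl.
    assert (0 <= c / eps * exp (- (eps * v))); [| lra].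
    apply Rmult_le_pos; [| left; apply exp_pos].
    apply Rdiv_le_0_compat; lra. }
assert (Hlim : exists l, filterlim (fun b => RInt F 0 b)
                           (Rbar_locally p_infty) (locally l)).
{ apply (filterlim_locally_cauchy (U := R_CompleteSpace)); intros d.
  assert (Hsmall : filterlim (fun u => c / eps * exp (- (eps * u)))
                     (Rbar_locally p_infty) (locally 0)).
  { replace 0 with (c / eps * 0) by ring.
    apply (filterlim_Rmult (Rbar_locally p_infty));
      [apply filterlim_const | now apply exp_decay]. }
  exists (fun u => 0 <= u /\ c / eps * exp (- (eps * u)) < d); split.
  - apply filter_and; [exists 0; intros u Hu; lra |].
    apply filterlim_locally with (eps := d) in Hsmall.
    revert Hsmall; apply filter_imp; intros u Hu.
    change (Rabs (c / eps * exp (- (eps * u)) - 0) < d) in Hu.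
    apply Rabs_def2 in Hu; lra.
  - intros u v [Hu Hud] [Hv Hvd].
    change (Rabs (RInt F 0 v - RInt F 0 u) < d).
    destruct (Rle_dec u v) as [Huv | Huv].
    + apply Rle_lt_trans with (2 := Hud); apply Htail; lra.
    + rewrite Rabs_minus_sym.
      apply Rle_lt_trans with (2 := Hvd); apply Htail; lra. }
destruct Hlim as [l Hl]; exists l.
apply (is_RInt_gen_ray F (fun b => RInt F 0 b)); [| exact Hl].
intros b Hb; apply (RInt_correct (V := R_CompleteNormedModule)), Hint, Hb.
Qed.

(** * Weighted Laplace integrals *)

Definition weight (n : nat) (s t : R) : R := exp (- (s * t)) * (t ^ n / INR (fact n)).

(** The convention of a zero value at index -1 makes the formula for the
    derivative of [weight n s] uniform in [n]. *)
Definition lower_weight (n : nat) (s t : R) : R :=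
  match n with O => 0 | S m => weight m s t end.

Lemma is_derive_weight (n : nat) (s t : R) :
  is_derive (weight n s) t (lower_weight n s t - s * weight n s t).
Proof.
unfold weight; destruct n as [|n]; unfold lower_weight, weight.
- auto_derive; [trivial | simpl; field].
- assert (H1 := INR_fact_neq_0 n).
  assert (H2 : INR (S n) <> 0) by (apply not_0_INR; lia).
  rewrite fact_simpl, mult_INR.
  auto_derive; [trivial |].
  change (match n with O => 1 | S _ => INR n + 1 end) with (INR (S n)).
  rewrite <- tech_pow_Rmult; field; split; assumption.
Qed.

Lemma continuous_weight (n : nat) (s t : R) : continuous (weight n s) t.
Proof.
apply (ex_derive_continuous (K := R_AbsRing) (V := R_NormedModule)).
eexists; apply is_derive_weight.
Qed.

Lemma weight_0 (n : nat) (s : R) : weight n s 0 = 0 ^ n.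
Proof.
unfold weight; rewrite Rmult_0_r, Ropp_0, exp_0.
destruct n as [|n]; [simpl; field |].
rewrite pow_i by lia; unfold Rdiv; ring.
Qed.

(** With [eps = (s - r) / 2], half of the gap between [s] and [r] absorbs the
    power of [t], because the Taylor polynomials of [exp] minorize it; the other
    half is the rate of decay. *)
Lemma laplace_integrand_dominated (n : nat) (r s M : R) (g : R -> R) :
  r < s ->
  (forall t, 0 <= t -> Rabs (g t) <= M * exp (r * t)) ->
  exists c eps, 0 < eps /\
    forall t, 0 <= t -> Rabs (laplace_integrand n s g t) <= c * exp (- (eps * t)).
Proof.
intros Hrs Hg.
set (eps := (s - r) / 2); assert (Heps : 0 < eps) by (unfold eps; lra).
exists (M / eps ^ n), eps; split; [exact Heps |]; intros t Ht.
assert (Hpow : 0 < eps ^ n) by now apply pow_lt.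
assert (Hf : 0 < INR (fact n)) by apply INR_fact_lt_0.
assert (Htn : 0 <= t ^ n / INR (fact n))
  by (apply Rdiv_le_0_compat; [now apply pow_le | exact Hf]).
assert (Htay : t ^ n / INR (fact n) <= exp (eps * t) / eps ^ n).
{ apply Rmult_le_reg_r with (eps ^ n); [exact Hpow |].
  replace (exp (eps * t) / eps ^ n * eps ^ n) with (exp (eps * t)) by (field; lra).
  assert (Het : 0 <= eps * t) by (apply Rmult_le_pos; lra).
  apply Rle_trans with (2 := exp_ge_taylor _ n Het).
  replace (t ^ n / INR (fact n) * eps ^ n) with ((eps * t) ^ n / INR (fact n))
    by (rewrite Rpow_mult_distr; field; lra).
  destruct n as [|n]; [apply Rle_refl |].
  rewrite tech5.
  assert (0 <= sum_f_R0 (fun k => (eps * t) ^ k / INR (fact k)) n); [| lra].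
  apply cond_pos_sum; intros k; apply Rdiv_le_0_compat;
    [now apply pow_le | apply INR_fact_lt_0]. }
unfold laplace_integrand; rewrite !Rabs_mult.
rewrite (Rabs_pos_eq (exp _)) by (left; apply exp_pos).
rewrite (Rabs_pos_eq (_ / _)) by exact Htn.
apply Rle_trans with
  (exp (- (s * t)) * (exp (eps * t) / eps ^ n) * (M * exp (r * t))).
- apply Rmult_le_compat; [| apply Rabs_pos | | now apply Hg].
  + apply Rmult_le_pos; [left; apply exp_pos | exact Htn].
  + apply Rmult_le_compat_l; [left; apply exp_pos | exact Htay].
- right.
  replace (- (eps * t)) with (- (s * t) + eps * t + r * t)
    by (unfold eps; field).
  rewrite !exp_plus; field; lra.
Qed.

Lemma ex_RInt_laplace_integrand (n : nat) (s b : R) (g : R -> R) :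
  continuous_on ray g -> 0 <= b -> ex_RInt (laplace_integrand n s g) 0 b.
Proof.
intros Hg Hb.
(* The values of [g] at negative arguments are arbitrary; [g (Rabs t)] is the
   even function with the same values on the ray. *)
apply (ex_RInt_ext (V := R_NormedModule) (fun t => weight n s t * g (Rabs t))).
- rewrite Rmin_left, Rmax_right by lra; intros t Ht.
  rewrite Rabs_pos_eq by lra; reflexivity.
- apply (ex_RInt_continuous (V := R_CompleteNormedModule)); intros z _.
  apply (continuous_mult (K := R_AbsRing)); [apply continuous_weight |].
  intros P HP.
  assert (Hz := Hg (Rabs z) (Rabs_pos z) P HP).
  generalize (continuous_Rabs z _ Hz); unfold filtermap; apply filter_imp.
  intros u Hu; apply Hu, Rabs_pos.
Qed.

(** The integrand is the derivative of [weight n s * g], which is continuous even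
    where [g] has no derivative. *)
Lemma is_RInt_laplace_derivative (n : nat) (s b : R) (g : R -> R) :
  continuous_on ray g ->
  holds_on_ray_but_finitely_many (ex_derive_ray g) ->
  piecewise_continuous_ray (Derive_ray g) ->
  0 <= b ->
  is_RInt (fun t => (lower_weight n s t - s * weight n s t) * g t
                    + laplace_integrand n s (Derive_ray g) t)
    0 b (weight n s b * g b - 0 ^ n * g 0).
Proof.
intros Hg Hd [Hpc [Hr Hl]] Hb.
assert (Hdw : forall t, continuous (fun u => lower_weight n s u - s * weight n s u) t).
{ intros t; apply (continuous_minus (V := R_NormedModule)).
  - destruct n as [|n]; [apply continuous_const | apply continuous_weight].
  - apply (continuous_mult (K := R_AbsRing));
      [apply continuous_const | apply continuous_weight]. }
assert (HK : forall (F : (R -> Prop) -> Prop), Filter F -> forall t l,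
  filter_le F (locally t) -> filterlim g F (locally (g t)) ->
  filterlim (Derive_ray g) F (locally l) ->
  filterlim (fun u => (lower_weight n s u - s * weight n s u) * g u
                    + laplace_integrand n s (Derive_ray g) u) F
    (locally ((lower_weight n s t - s * weight n s t) * g t + weight n s t * l))).
{ intros F FF t l HF HgF HlF.
  apply (filterlim_Rplus F); apply (filterlim_Rmult F); trivial.
  - exact (filterlim_filter_le_1 _ HF (Hdw t)).
  - exact (filterlim_filter_le_1 _ HF (continuous_weight n s t)). }
destruct (Hd b) as [E1 HE1]; destruct (Hpc b) as [E2 HE2].
rewrite <- (weight_0 n s).
apply (is_RInt_derive_off_list (fun t => weight n s t * g t) _ (E1 ++ E2));
  [exact Hb | | | | |]; intros t Ht.
- apply (filterlim_Rmult (at_right t)).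
  + apply (filterlim_filter_le_1 _ (filter_le_within _)), continuous_weight.
  + apply (filterlim_filter_le_1 _ (at_right_le_ray t (proj1 Ht))), Hg, Ht.
- apply (filterlim_Rmult (at_left t)).
  + apply (filterlim_filter_le_1 _ (filter_le_within _)), continuous_weight.
  + apply (filterlim_filter_le_1 _ (at_left_le_ray t (proj1 Ht))), Hg.
    unfold ray; lra.
- destruct (Hr t (proj1 Ht)) as [l Hlr]; eexists.
  apply (HK (at_right t) _ t l); [apply filter_le_within | | exact Hlr].
  apply (filterlim_filter_le_1 _ (at_right_le_ray t (proj1 Ht))), Hg, Ht.
- destruct (Hl t (proj1 Ht)) as [l Hll]; eexists.
  apply (HK (at_left t) _ t l); [apply filter_le_within | | exact Hll].
  apply (filterlim_filter_le_1 _ (at_left_le_ray t (proj1 Ht))), Hg.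
  unfold ray; lra.
- intros HE.
  assert (Ht0 : 0 < t) by lra.
  split.
  + apply (is_derive_mult (K := R_AbsRing) (weight n s) g t);
      [apply is_derive_weight | | exact Rmult_comm].
    apply ex_derive_ray_interior; [exact Ht0 |].
    apply HE1; [lra |]; intros H; apply HE, in_or_app; now left.
  + apply (HK (locally t) _ t); [now intros P HP | |];
      apply (filterlim_filter_le_1 _ (locally_le_ray t Ht0)).
    * apply Hg; unfold ray; lra.
    * apply HE2; [lra |]; intros H; apply HE, in_or_app; now right.
Qed.

(** Letting [b] tend to infinity in the integration by parts on [0, b]. The value
    [A (-1) = 0] stands for the integral against [lower_weight 0 s = 0]. *)
Lemma laplace_derivative_step (r s M : R) (g : R -> R) (A : Z -> R) :
  r < s ->
  continuous_on ray g ->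
  (forall t, 0 <= t -> Rabs (g t) <= M * exp (r * t)) ->
  holds_on_ray_but_finitely_many (ex_derive_ray g) ->
  piecewise_continuous_ray (Derive_ray g) ->
  A (-1)%Z = 0 ->
  (forall n, is_RInt_gen (laplace_integrand n s g)
               (at_point 0) (Rbar_locally p_infty) (A (Z.of_nat n))) ->
  forall n, is_RInt_gen (laplace_integrand n s (Derive_ray g))
              (at_point 0) (Rbar_locally p_infty)
              (s * A (Z.of_nat n) - A (Z.of_nat n - 1)%Z - 0 ^ n * g 0).
Proof.
intros Hrs Hg HM Hd Hpc HA0 HA n.
set (J := fun b => RInt (laplace_integrand n s g) 0 b).
assert (HJ : forall b, 0 <= b -> is_RInt (laplace_integrand n s g) 0 b (J b)).
{ intros b Hb; apply (RInt_correct (V := R_CompleteNormedModule)).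
  now apply ex_RInt_laplace_integrand. }
assert (HL : exists L : R -> R,
  (forall b, 0 <= b -> is_RInt (fun t => lower_weight n s t * g t) 0 b (L b)) /\
  filterlim L (Rbar_locally p_infty) (locally (A (Z.of_nat n - 1)%Z))).
{ destruct n as [|n].
  - exists (fun _ => 0); split.
    + intros b Hb.
      apply (is_RInt_ext (V := R_NormedModule) (fun _ => 0));
        [intros t _; simpl; ring |].
      assert (Hz := is_RInt_const (V := R_NormedModule) 0 b 0).
      rewrite (Rmult_0_r (b - 0) : scal (b - 0) (0 : R_NormedModule) = 0) in Hz.
      exact Hz.
    + simpl Z.sub; rewrite HA0; apply filterlim_const.
  - exists (fun b => RInt (laplace_integrand n s g) 0 b); split.
    + intros b Hb; apply (RInt_correct (V := R_CompleteNormedModule)).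
      now apply (ex_RInt_laplace_integrand n).
    + replace (Z.of_nat (S n) - 1)%Z with (Z.of_nat n) by lia.
      apply filterlim_RInt_of_RInt_gen, HA. }
destruct HL as [L [HL HLlim]].
apply (is_RInt_gen_ray _
  (fun b => (weight n s b * g b - 0 ^ n * g 0) - (L b - s * J b))).
- intros b Hb.
  apply (is_RInt_ext (V := R_NormedModule)
    (fun t => minus ((lower_weight n s t - s * weight n s t) * g t
                     + laplace_integrand n s (Derive_ray g) t)
                    (minus (lower_weight n s t * g t)
                           (scal s (laplace_integrand n s g t))))).
  { intros t _; unfold minus, plus, opp, scal, laplace_integrand, weight; simpl.
    unfold mult; simpl; ring. }
  apply (is_RInt_minus (V := R_NormedModule));
    [now apply is_RInt_laplace_derivative |].
  apply (is_RInt_minus (V := R_NormedModule)); [now apply HL |].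
  now apply (is_RInt_scal (V := R_NormedModule)), HJ.
- destruct (laplace_integrand_dominated n r s M g Hrs HM) as [c [eps [Heps Hc]]].
  assert (Hbd : filterlim (fun b => weight n s b * g b)
                  (Rbar_locally p_infty) (locally 0))
    by exact (filterlim_exp_dominated _ c eps Heps Hc).
  assert (HJlim : filterlim J (Rbar_locally p_infty) (locally (A (Z.of_nat n))))
    by apply filterlim_RInt_of_RInt_gen, HA.
  replace (s * A (Z.of_nat n) - A (Z.of_nat n - 1)%Z - 0 ^ n * g 0)
    with (0 + - (0 ^ n * g 0) + (-1 * A (Z.of_nat n - 1)%Z + s * A (Z.of_nat n)))
    by ring.
  apply (filterlim_ext (fun b => weight n s b * g b + - (0 ^ n * g 0)
                                 + (-1 * L b + s * J b)));
    [intros b; ring |].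
  repeat (apply (filterlim_Rplus (Rbar_locally p_infty))
          || apply (filterlim_Rmult (Rbar_locally p_infty)));
    trivial; apply filterlim_const.
Qed.

(** * The boundary terms *)

Lemma nabla_pow_neg (p : nat) (psi : Z -> R -> R) (s : R) :
  (forall m, (m < 0)%Z -> psi m s = 0) ->
  forall m, (m < 0)%Z -> nabla_pow p psi m s = 0.
Proof.
intros Hpsi; induction p as [|p IH]; [exact Hpsi |]; intros m Hm.
simpl; unfold nabla; rewrite !IH by lia; ring.
Qed.

Lemma sum_n_m_linear (c : R) (u v w : nat -> R) (n m : nat) :
  (forall k, (n <= k <= m)%nat -> w k = c * u k + v k) ->
  sum_n_m w n m = c * sum_n_m u n m + sum_n_m v n m.
Proof.
intros Hw; rewrite (sum_n_m_ext_loc _ _ _ _ Hw).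
transitivity (plus (sum_n_m (fun k => mult c (u k)) n m) (sum_n_m v n m)).
- apply (sum_n_m_plus (G := R_AbelianMonoid)).
- now rewrite (sum_n_m_mult_l (K := R_Ring)).
Qed.

(** The closed form of the correction after [p] integrations by parts, where
    [a j] is to be the [j]-th derivative at 0. *)
Definition boundary (a : nat -> R) (s : R) (p n : nat) : R :=
  (-1) ^ n * sum_n_m (fun j => Binomial.C (p - j) n * s ^ (p - j - n) * a (j - 1)%nat)
               1 (p - n).

Lemma boundary_past (a : nat -> R) (s : R) (p n : nat) :
  (p <= n)%nat -> boundary a s p n = 0.
Proof.
intros H; unfold boundary; rewrite sum_n_m_zero by lia.
apply Rmult_0_r.
Qed.

Lemma binomial_0 (m : nat) : Binomial.C m 0 = 1.
Proof.
unfold Binomial.C; rewrite Nat.sub_0_r; simpl; field; apply INR_fact_neq_0.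
Qed.

Lemma binomial_diag (m : nat) : Binomial.C m m = 1.
Proof.
unfold Binomial.C; rewrite Nat.sub_diag; simpl; field; apply INR_fact_neq_0.
Qed.

Lemma boundary_0 (a : nat -> R) (s : R) (p : nat) :
  boundary a s (S p) 0 = s * boundary a s p 0 + a p.
Proof.
unfold boundary; rewrite !Nat.sub_0_r, sum_n_Sm by lia.
rewrite !pow_O, !Rmult_1_l.
rewrite Nat.sub_diag, binomial_0; simpl pow.
rewrite Nat.sub_succ, Nat.sub_0_r.
change (sum_n_m (fun j => Binomial.C (S p - j) 0 * s ^ (S p - j - 0) * a (j - 1)%nat) 1 p
        + 1 * 1 * a p
        = s * sum_n_m (fun j => Binomial.C (p - j) 0 * s ^ (p - j - 0) * a (j - 1)%nat) 1 p
          + a p).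
rewrite (sum_n_m_linear s
  (fun j => Binomial.C (p - j) 0 * s ^ (p - j - 0) * a (j - 1)%nat) (fun _ => 0)).
- rewrite sum_n_m_const; ring.
- intros j Hj; rewrite !binomial_0.
  replace (S p - j - 0)%nat with (S (p - j - 0)) by lia.
  rewrite <- tech_pow_Rmult; ring.
Qed.

(** Pascal's rule, term by term, when [n < p]. The sum in [boundary a s p n] has one
    term more than that in [boundary a s p (S n)]; its coefficient [C n n = 1] is
    that of the last term on the left, [C (n+1) (n+1) = 1]. *)
Lemma boundary_S (a : nat -> R) (s : R) (p n : nat) :
  boundary a s (S p) (S n) = s * boundary a s p (S n) - boundary a s p n.
Proof.
destruct (Nat.le_gt_cases p n) as [Hpn | Hpn].
{ rewrite !boundary_past by lia; ring. }
unfold boundary.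
replace (S p - S n)%nat with (S (p - S n)) by lia.
replace (p - n)%nat with (S (p - S n)) by lia.
rewrite !sum_n_Sm by lia.
set (q := (p - S n)%nat).
replace (S p - S q)%nat with (S n) by lia.
replace (p - S q)%nat with n by lia.
rewrite !binomial_diag, !Nat.sub_diag, Nat.sub_succ, Nat.sub_0_r.
rewrite (sum_n_m_linear s
  (fun j => Binomial.C (p - j) (S n) * s ^ (p - j - S n) * a (j - 1)%nat)
  (fun j => Binomial.C (p - j) n * s ^ (p - j - n) * a (j - 1)%nat)).
- unfold plus; simpl; ring.
- intros j Hj; rewrite Nat.sub_succ_l by lia.
  rewrite <- pascal by lia.
  replace (S (p - j) - S n)%nat with (S (p - j - S n)) by lia.
  replace (p - j - n)%nat with (S (p - j - S n)) by lia.
  rewrite <- tech_pow_Rmult; ring.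
Qed.

(** * Derivatives of higher order *)

Section HigherDerivatives.

Variables (p : nat) (f : R -> R) (r s : R).
Hypothesis Hp : (1 <= p)%nat.
Hypothesis HC : C_ray (p - 1) f.
Hypothesis Hd : holds_on_ray_but_finitely_many (ex_derive_ray_n f p).
Hypothesis Hpc : piecewise_continuous_ray (Derive_ray_n f p).
Hypothesis Hexp : forall k, (k <= p)%nat ->
  exponential_order (fun t => ray t /\ ex_derive_ray_n f k t) (Derive_ray_n f k) r.
Hypothesis Hrs : r < s.

(** Below order [p] every derivative exists on the whole ray, so the exponential
    bound holds there without exceptional points. *)
Lemma derivative_dominated (k : nat) :
  (k <= p - 1)%nat ->
  exists M, forall t, 0 <= t -> Rabs (Derive_ray_n f k t) <= M * exp (r * t).
Proof.
intros Hk; destruct (Hexp k) as [M [_ HM]]; [lia |].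
exists M; intros t Ht; left; apply HM; split; [exact Ht |].
now apply HC.
Qed.

Lemma ex_laplace (n : nat) :
  ex_RInt_gen (laplace_integrand n s f) (at_point 0) (Rbar_locally p_infty).
Proof.
destruct (derivative_dominated 0) as [M HM]; [lia |].
destruct (laplace_integrand_dominated n r s M f Hrs HM) as [c [eps [Heps Hc]]].
apply (ex_RInt_gen_exp_dominated _ c eps Heps); [| exact Hc].
intros b Hb; apply ex_RInt_laplace_integrand; [| exact Hb].
apply (proj2 HC 0%nat); lia.
Qed.

Lemma phi_neg (m : Z) : (m < 0)%Z -> phi f m s = 0.
Proof.
intros Hm; unfold phi; now rewrite (proj2 (Z.ltb_lt m 0) Hm).
Qed.

Lemma is_laplace_derivative_n (k : nat) :
  (k <= p)%nat ->
  forall n, is_RInt_gen (laplace_integrand n s (Derive_ray_n f k))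
              (at_point 0) (Rbar_locally p_infty)
              (nabla_pow k (phi f) (Z.of_nat n) s
               - boundary (fun j => Derive_ray_n f j 0) s k n).
Proof.
set (a := fun j => Derive_ray_n f j 0).
induction k as [|k IH]; intros Hk n.
- rewrite boundary_past, Rminus_0_r by lia; simpl; unfold phi.
  rewrite (proj2 (Z.ltb_ge _ _)) by lia; rewrite Nat2Z.id.
  apply (RInt_gen_correct (V := R_CompleteNormedModule)), ex_laplace.
- destruct (derivative_dominated k) as [M HM]; [lia |].
  assert (Hpred : forall m : nat, (Z.of_nat (S m) - 1 = Z.of_nat m)%Z) by (intros; lia).
  (* The integrals for all indices, continued by 0 to negative ones like [phi]. *)
  set (A := fun m : Z => nabla_pow k (phi f) m s
              - if (m <? 0)%Z then 0 else boundary a s k (Z.to_nat m)).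
  assert (HAn : forall m, A (Z.of_nat m)
                  = nabla_pow k (phi f) (Z.of_nat m) s - boundary a s k m).
  { intros m; unfold A; rewrite (proj2 (Z.ltb_ge _ _)) by lia.
    now rewrite Nat2Z.id. }
  assert (HA0 : A (-1)%Z = 0).
  { unfold A; rewrite nabla_pow_neg; [simpl; ring | exact phi_neg | lia]. }
  replace (nabla_pow (S k) (phi f) (Z.of_nat n) s - boundary a s (S k) n)
    with (s * A (Z.of_nat n) - A (Z.of_nat n - 1)%Z - 0 ^ n * Derive_ray_n f k 0).
  + apply (laplace_derivative_step r s M); trivial.
    * apply HC; lia.
    * destruct (Nat.eq_dec (S k) p) as [Heq | Hne].
      -- rewrite <- Heq in Hd; exact Hd.
      -- intros b; exists nil; intros t Ht _.
         apply (proj1 HC (S k)); [lia | apply Ht].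
    * destruct (Nat.eq_dec (S k) p) as [Heq | Hne].
      -- rewrite <- Heq in Hpc; exact Hpc.
      -- apply continuous_on_ray_piecewise.
         apply (proj2 HC (S k)); lia.
    * intros m; rewrite HAn; apply IH; lia.
  + simpl nabla_pow; unfold nabla.
    destruct n as [|n].
    * rewrite boundary_0; simpl (Z.of_nat 0 - 1)%Z.
      rewrite HA0, (HAn 0%nat).
      rewrite (nabla_pow_neg k (phi f) s phi_neg (-1)) by lia.
      unfold a; simpl; ring.
    * rewrite boundary_S, Hpred, !HAn, pow_i by lia; ring.
Qed.

End HigherDerivatives.

Theorem theorem3 :
  forall (p : nat) (f : R -> R) (r s : R),
    (1 <= p)%nat ->
    C_ray (p - 1) f ->
    holds_on_ray_but_finitely_many (ex_derive_ray_n f p) ->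
    piecewise_continuous_ray (Derive_ray_n f p) ->
    0 < r ->
    (forall k : nat, (k <= p)%nat ->
       exponential_order (fun t => ray t /\ ex_derive_ray_n f k t)
                         (Derive_ray_n f k) r) ->
    r < s ->
    (forall n : nat,
       ex_RInt_gen (laplace_integrand n s f)
                   (at_point 0) (Rbar_locally p_infty)) /\
    (forall n : nat,
       ((p <= n)%nat ->
          is_RInt_gen (laplace_integrand n s (Derive_ray_n f p))
            (at_point 0) (Rbar_locally p_infty)
            (nabla_pow p (phi f) (Z.of_nat n) s)) /\
       ((n <= p - 1)%nat ->
          is_RInt_gen (laplace_integrand n s (Derive_ray_n f p))
            (at_point 0) (Rbar_locally p_infty)
            (nabla_pow p (phi f) (Z.of_nat n) s
             - (-1) ^ n *
               sum_n_m (fun j : nat =>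
                          Binomial.C (p - j) n * s ^ (p - j - n)
                          * Derive_ray_n f (j - 1) 0)
                       1 (p - n)))).
Proof.
intros p f r s Hp HC Hd Hpc _ Hexp Hrs; split.
- intros n; now apply (ex_laplace p f r s).
- intros n.
  assert (H := is_laplace_derivative_n p f r s Hp HC Hd Hpc Hexp Hrs p (le_n p) n).
  split; intros Hn; [| exact H].
  now rewrite boundary_past, Rminus_0_r in H by exact Hn.
Qed.
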